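(* For all graphs $G_1$ and $G_2$, $\chi_i(G_1 \Box G_2) \leq \chi_i(G_1) + \chi_i(G_2)$.
   Context: $G_1\Box G_2$ is the Cartesian product: vertex set $V(G_1)\times V(G_2)$, with $(u_1,u_2)$ adjacent to $(v_1,v_2)$ iff either $u_1v_1\in E(G_1)$ and $u_2=v_2$, or $u_1=v_1$ and $u_2v_2\in E(G_2)$. For a graph $G$, let $D(G)$ be the digraph obtained by replacing each edge $uv$ by the two opposite arcs $uv$ and $vu$, with arc set $A(G)$. Two distinct arcs $uv$ and $xy$ are adjacent if $u=x$, or $v=x$, or $y=u$. An incidence coloring is a map $\sigma: A(G)\to C$ assigning distinct colors to adjacent arcs; the incidence chromatic number $\chi_i(G)$ is the minimum $|C|$ over all incidence colorings. *)

(* Defs.v *)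
From mathcomp Require Import all_boot.

Set Implicit Arguments.
Unset Strict Implicit.
Unset Printing Implicit Defensive.

(** Graphs are finite and simple. *)
Record sgraph := SGraph {
  vertex :> finType;
  edge : rel vertex;
  edge_sym : symmetric edge;
  edge_irrefl : irreflexive edge
}.

Section CartesianProduct.
Variables G1 G2 : sgraph.

Definition cart_edge : rel (vertex G1 * vertex G2) :=
  fun u v =>
    (edge u.1 v.1 && (u.2 == v.2)) || ((u.1 == v.1) && edge u.2 v.2).

Lemma cart_edge_sym : symmetric cart_edge.
Proof.
move=> u v; rewrite /cart_edge (edge_sym u.1) (edge_sym u.2).
by rewrite (eq_sym u.1) (eq_sym u.2).
Qed.

Lemma cart_edge_irrefl : irreflexive cart_edge.
Proof. by move=> u; rewrite /cart_edge !edge_irrefl andbF. Qed.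

Definition cart_prod : sgraph := SGraph cart_edge_sym cart_edge_irrefl.

End CartesianProduct.

Section IncidenceColoring.
Variable G : sgraph.

(** The arc set A(G) of D(G): since [edge] is symmetric, each edge uv
    contributes exactly the two arcs (u, v) and (v, u). *)
Definition arc : finType := {a : vertex G * vertex G | edge a.1 a.2}.

Definition arc_tail (a : arc) : vertex G := (val a).1.
Definition arc_head (a : arc) : vertex G := (val a).2.

Definition arc_adj (a b : arc) : bool :=
  (a != b) &&
  [|| arc_tail a == arc_tail b, arc_head a == arc_tail b
    | arc_head b == arc_tail a].

Definition incidence_coloring (C : eqType) (s : arc -> C) : bool :=
  [forall a : arc, forall b : arc, arc_adj a b ==> (s a != s b)].

Definition incidence_colorable (k : nat) : bool :=
  [exists s : {ffun arc -> 'I_k}, incidence_coloring s].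

Lemma ex_incidence_colorable : exists k, incidence_colorable k.
Proof.
exists #|arc|; apply/existsP; exists [ffun a => enum_rank a].
apply/forallP=> a; apply/forallP=> b; apply/implyP=> /andP[ab _].
by rewrite !ffunE (inj_eq enum_rank_inj).
Qed.

Definition incidence_chromatic_number : nat := ex_minn ex_incidence_colorable.

End IncidenceColoring.

(* Main.v *)
Require Import Defs.
From mathcomp Require Import all_boot.

(** Arcs of the product along the first factor inherit the colors of an optimal
    coloring of G1, those along the second factor inherit colors of G2, taken
    from a disjoint palette. Two adjacent arcs along the same factor lie in the
    same copy of it, where their projections are still distinct and adjacent. *)

(* Colors are natural numbers and the coloring is a total function on pairs of
   vertices, with junk values off the edges: this avoids the subtype of arcs
   and the possibly empty type ['I_k]. *)
Lemma incidence_colorableP (G : sgraph) (k : nat) :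
  reflect (exists2 f : G -> G -> nat,
             forall u v, edge u v -> f u v < k
           & forall u v x y, edge u v -> edge x y -> (u, v) != (x, y) ->
               [|| u == x, v == x | y == u] -> f u v != f x y)
          (incidence_colorable G k).
Proof.
apply: (iffP existsP) => [[s /forallP s_col]|[f f_lt f_col]].
  pose mk u v (uv : edge u v) : Defs.arc G :=
    exist (fun a : G * G => edge a.1 a.2) (u, v) uv.
  pose f u v := if insub (u, v) is Some a then val (s a) else 0.
  have fE u v (uv : edge u v) : f u v = s (mk u v uv).
    by rewrite /f -[(u, v)]/(val (mk u v uv)) valK.
  exists f => [u v uv|u v x y uv xy neq adj]; first by rewrite (fE _ _ uv).
  rewrite (fE _ _ uv) (fE _ _ xy) (inj_eq val_inj).
  have /forallP/(_ (mk x y xy))/implyP := s_col (mk u v uv).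
  by apply; rewrite /arc_adj -(inj_eq val_inj) neq.
exists [ffun a : Defs.arc G => Ordinal (f_lt _ _ (valP a))].
apply/forallP=> -[[u v] uv]; apply/forallP=> -[[x y] xy].
apply/implyP=> /andP[neq adj]; rewrite !ffunE -(inj_eq val_inj) /=.
by apply: f_col => //; rewrite -(inj_eq val_inj) in neq.
Qed.

Lemma incidence_colorable_cart_prod (G1 G2 : sgraph) (k1 k2 : nat) :
  incidence_colorable G1 k1 -> incidence_colorable G2 k2 ->
  incidence_colorable (cart_prod G1 G2) (k1 + k2).
Proof.
move=> /incidence_colorableP[f f_lt f_col] /incidence_colorableP[g g_lt g_col].
have cartP (u v : cart_prod G1 G2) : edge u v ->
    edge u.1 v.1 /\ u.2 = v.2 \/ [/\ u.1 = v.1, edge u.2 v.2 & u.2 != v.2].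
  case/orP=> /andP[]; first by move=> uv /eqP; left.
  move=> /eqP uv1 uv2; right; split=> //.
  by apply: contraTneq uv2 => ->; rewrite edge_irrefl.
apply/incidence_colorableP.
(* On edges the test tells the two factors apart, loops being excluded; the shift by [k1] makes the
   palettes disjoint. *)
exists (fun u v => if u.2 == v.2 then f u.1 v.1 else k1 + g u.2 v.2).
  move=> u v /cartP[[uv ->]|[_ uv /negPf->]].
    by rewrite eqxx ltn_addr ?f_lt.
  by rewrite ltn_add2l g_lt.
move=> [u1 u2] [v1 v2] [x1 x2] [y1 y2] /cartP/= uvP /cartP/= xyP.
case: uvP => [[uv <-]|[<- uv /negPf->]];
  case: xyP => [[xy <-]|[<- xy /negPf->]]; rewrite ?eqxx => neq adj.
(* Both arcs keep their second coordinate, so any shared endpoint puts them in the same copy of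
   [G1]. *)
- have eq2 : u2 = x2 by case/or3P: adj => /eqP[].
  move: neq adj; rewrite eq2 !xpair_eqE !eqxx !andbT => neq adj.
  by apply: f_col; rewrite ?xpair_eqE.
(* Mixed directions: one color is below [k1], the other at least [k1]. *)
- by rewrite ltn_eqF // ltn_addr // f_lt.
- by rewrite gtn_eqF // ltn_addr // f_lt.
- have eq1 : u1 = x1 by case/or3P: adj => /eqP[].
  move: neq adj; rewrite eq1 !xpair_eqE !eqxx /= => neq adj.
  by rewrite eqn_add2l; apply: g_col; rewrite ?xpair_eqE.
Qed.

Theorem theorem4p2 (G1 G2 : sgraph) :
  incidence_chromatic_number (cart_prod G1 G2)
    <= incidence_chromatic_number G1 + incidence_chromatic_number G2.
Proof.
rewrite /incidence_chromatic_number.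
(* By minimality of [k], it suffices to color the product with the sum of the two optima. *)
case: ex_minnP => k _; apply.
case: ex_minnP => k1 col1 _; case: ex_minnP => k2 col2 _.
exact: incidence_colorable_cart_prod.
Qed.
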